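(* Let $G$ be a square and let $H$ be any graph. Then both lexicographic products $G\circ H$ and $H\circ G$ are squares.
   Context: For graphs $X,Y$, the lexicographic product $X\circ Y$ has vertex set $V(X)\times V(Y)$, with $(x,y)$ adjacent to $(x',y')$ iff either $xx'\in E(X)$, or $x=x'$ and $yy'\in E(Y)$. All graphs are finite, simple, with nonempty vertex sets. A partially labeled graph is a graph $K$ together with an injective map $\theta: L\to V(K)$, $L\subseteq\mathbb{N}$, whose image $\theta(L)$ is nonempty and a proper subset of $V(K)$; vertices in $\theta(L)$ are labeled. The square $KK$ is obtained from two disjoint copies of $K$ by identifying each labeled vertex $\theta(\ell)$ of the first copy with $\theta(\ell)$ of the second copy (keeping all edges, merging double edges). A graph is a square if it is isomorphic to $KK$ for some partially labeled graph $K$. *)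

(* Defs.v *)
From mathcomp Require Import all_boot finmap.

Set Implicit Arguments.
Unset Strict Implicit.
Unset Printing Implicit Defensive.

Record sgraph := SGraph {
  vertex :> finType;
  adj : rel vertex;
  adj_sym : symmetric adj;
  adj_irrefl : irreflexive adj;
  vertex_gt0 : 0 < #|vertex|
}.

Definition isomorphic (X Y : sgraph) : Prop :=
  exists2 f : X -> Y, bijective f & forall x x', adj (f x) (f x') = adj x x'.

Section Lexicographic.
Variables X Y : sgraph.

Definition lex_adj : rel (X * Y) :=
  fun p q => adj p.1 q.1 || ((p.1 == q.1) && adj p.2 q.2).

Lemma lex_adj_sym : symmetric lex_adj.
Proof. by move=> p q; rewrite /lex_adj adj_sym eq_sym (adj_sym p.2). Qed.

Lemma lex_adj_irrefl : irreflexive lex_adj.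
Proof. by move=> p; rewrite /lex_adj !adj_irrefl andbF. Qed.

Lemma lex_vertex_gt0 : 0 < #|{: X * Y}|.
Proof. by rewrite card_prod muln_gt0 !vertex_gt0. Qed.

Definition lexprod : sgraph :=
  SGraph lex_adj_sym lex_adj_irrefl lex_vertex_gt0.
End Lexicographic.

(* The set of labels is taken finite, which loses nothing: it injects into   *)
(* the finite vertex set.                                                    *)
Record plgraph := PLGraph {
  plg :> sgraph;
  labels : {fset nat};
  theta : labels -> plg;
  theta_inj : injective theta;
  theta_nonempty : exists v, v \in codom theta;
  theta_proper : exists v, v \notin codom theta
}.

Section Square.
Variable K : plgraph.

(* The vertex (b, v) of the disjoint union of two copies of K is the vertex v *)
(* of copy b.                                                                 *)
Definition copies_adj : rel (bool * K) :=
  fun p q => (p.1 == q.1) && adj p.2 q.2.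

Definition glue : rel (bool * K) :=
  fun p q => (p == q) ||
    [exists l : labels K, (p.2 == theta l) && (q.2 == theta l)].

Lemma glue_snd p q : glue p q -> p.2 = q.2.
Proof. by case/orP=> [/eqP->//|/existsP[l /andP[/eqP-> /eqP->]]]. Qed.

Lemma glue_refl : reflexive glue.
Proof. by move=> p; rewrite /glue eqxx. Qed.

Lemma glue_sym : symmetric glue.
Proof.
move=> p q; rewrite /glue eq_sym; congr (_ || _).
by apply: eq_existsb => l; rewrite andbC.
Qed.

Lemma glue_trans : transitive glue.
Proof.
move=> q p r pq qr; case/orP: (pq) => [/eqP->//|/existsP[l /andP[pl ql]]].
apply/orP; right; apply/existsP; exists l.
by rewrite pl -(glue_snd qr) ql.
Qed.

(* The identified vertices are the equivalence classes of glue. *)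
Definition square_vertex : Type :=
  {C : {set bool * K} | C \in equivalence_partition glue setT}.

Lemma square_vertex_class (u : square_vertex) p q :
  p \in val u -> q \in val u -> glue p q.
Proof.
case/imsetP: (valP u) => r _ ->; rewrite !inE /= glue_sym => rp rq.
exact: glue_trans rp rq.
Qed.

(* Being a relation on classes, this merges the double edges between labeled *)
(* vertices.                                                                 *)
Definition square_adj : rel square_vertex :=
  fun u w => [exists p in val u, exists q in val w, copies_adj p q].

Lemma square_adj_sym : symmetric square_adj.
Proof.
suff sub u w : square_adj u w -> square_adj w u.
  by move=> u w; apply/idP/idP; exact: sub.
case/exists_inP=> p pu /exists_inP[q qw]; rewrite /copies_adj.
rewrite eq_sym adj_sym => pq.
by apply/exists_inP; exists q => //; apply/exists_inP; exists p.
Qed.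

Lemma square_adj_irrefl : irreflexive square_adj.
Proof.
move=> u; apply/negbTE/negP => /exists_inP[p pu /exists_inP[q qu]].
by rewrite /copies_adj (glue_snd (square_vertex_class pu qu)) adj_irrefl andbF.
Qed.

Lemma square_vertex_gt0 : 0 < #|{: square_vertex}|.
Proof.
have /card_gt0P[v _] := vertex_gt0 K.
pose C := [set q in setT | glue (true, v) q].
have CP : C \in equivalence_partition glue setT by exact: imset_f.
by apply/card_gt0P; exists (Sub C CP).
Qed.

Definition square : sgraph :=
  SGraph square_adj_sym square_adj_irrefl square_vertex_gt0.
End Square.

Definition is_square (G : sgraph) : Prop :=
  exists K : plgraph, isomorphic G (square K).

(* Main.v *)
Require Import Defs.
From mathcomp Require Import all_boot finmap.

Set Implicit Arguments.
Unset Strict Implicit.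
Unset Printing Implicit Defensive.

(* A graph is a square iff it has a reflection: an involutive automorphism s  *)
(* with a fixed vertex, together with a nonempty set A such that A, s A and   *)
(* the fixed vertices of s partition the vertex set and no edge joins A to    *)
(* s A.  In the square KK, s exchanges the two copies and A is the unlabeled  *)
(* part of one of them; conversely, K is recovered as the subgraph induced on *)
(* A and the fixed vertices, the latter being labeled.  If (s, A) is a        *)
(* reflection of G, then (s x id, A x V(H)) is one of the product of G with   *)
(* H.  For the product of H with G the reflection has to be confined to a     *)
(* single copy {h0} x V(G), all other vertices staying fixed, since           *)
(* reflecting two adjacent copies would join A to s A.                        *)

(* A gluing presents G as the square of K with labeled set L, the vertex v of *)
(* copy b being sent to f (b, v).                                             *)
Record gluing (K : sgraph) (L : {set K}) (G : sgraph) (f : bool * K -> G) :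
  Prop := Gluing {
  gluing_surj : forall x, exists p, f p = x;
  gluing_eq : forall p q,
    (f p == f q) = (p.2 == q.2) && ((p.1 == q.1) || (p.2 \in L));
  gluing_adj : forall p q, adj (f p) (f q) =
    adj p.2 q.2 && [|| p.1 == q.1, p.2 \in L | q.2 \in L];
  gluing_labeled : exists v, v \in L;
  gluing_unlabeled : exists v, v \notin L
}.

Lemma gluing_section (K : sgraph) (L : {set K}) (G : sgraph)
    (f : bool * K -> G) :
  gluing L f -> exists r : G -> bool * K, cancel r f.
Proof. by move=> f_glue; exact: fin_all_exists (gluing_surj f_glue). Qed.

Lemma gluing_isomorphic (K : sgraph) (L : {set K}) (G G' : sgraph)
    (f : bool * K -> G) (f' : bool * K -> G') :
  gluing L f -> gluing L f' -> isomorphic G G'.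
Proof.
move=> f_glue f'_glue.
have [r rK] := gluing_section f_glue; have [r' r'K] := gluing_section f'_glue.
have eq_ff' p q : (f p == f q) = (f' p == f' q).
  by rewrite (gluing_eq f_glue) (gluing_eq f'_glue).
exists (f' \o r) => [|x y] /=.
  exists (f \o r') => x /=; apply/eqP.
    by rewrite -[eqbRHS]rK eq_ff' r'K.
  by rewrite -[eqbRHS]r'K -eq_ff' rK.
by rewrite -{2}[x]rK -{2}[y]rK (gluing_adj f_glue) (gluing_adj f'_glue).
Qed.

Lemma gluing_comp_isomorphism (K : sgraph) (L : {set K}) (G G' : sgraph)
    (f : bool * K -> G) (g : G -> G') :
  bijective g -> (forall x y, adj (g x) (g y) = adj x y) ->
  gluing L f -> gluing L (g \o f).
Proof.
move=> g_bij g_adj [f_surj f_eq f_adj L_ex L_proper]; split=> // [y|p q|p q] /=.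
- have [h _ hK] := g_bij; have [p fp] := f_surj (h y).
  by exists p; rewrite /= fp hK.
- by rewrite (inj_eq (bij_inj g_bij)) f_eq.
- by rewrite g_adj f_adj.
Qed.

Section SquareGluing.
Variable K : plgraph.
Implicit Types p q : bool * K.

Definition labeled : {set K} := [set v in codom (@theta K)].

Lemma glueE p q :
  glue p q = (p.2 == q.2) && ((p.1 == q.1) || (p.2 \in labeled)).
Proof.
rewrite /glue inE; case: p q => [b v] [c w] /=; rewrite xpair_eqE.
have -> : [exists l : labels K, (v == theta l) && (w == theta l)] =
          (v == w) && (v \in codom (@theta K)).
  apply/existsP/andP => [[l /andP[/eqP-> /eqP->]]|[/eqP<- /codomP[l ->]]].
    by split=> //; exact: codom_f.
  by exists l; rewrite eqxx.
by rewrite andbC andb_orr.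
Qed.

Definition square_class p : square K :=
  Sub [set q in setT | glue p q] (imset_f _ (in_setT p)).

Lemma in_square_class p q : (q \in val (square_class p)) = glue p q.
Proof. by rewrite SubK !inE. Qed.

Lemma square_class_surj (u : square K) : exists p, square_class p = u.
Proof. by case/imsetP: (valP u) => p _ up; exists p; exact: val_inj. Qed.

Lemma square_class_eq p q : (square_class p == square_class q) = glue p q.
Proof.
rewrite -val_eqE; apply/eqP/idP => [eq_pq|pq].
  by rewrite -in_square_class eq_pq in_square_class glue_refl.
apply/setP => r; rewrite !in_square_class.
apply/idP/idP; last exact: glue_trans.
by apply: glue_trans; rewrite glue_sym.
Qed.

Lemma square_class_adj p q : adj (square_class p) (square_class q) =
  adj p.2 q.2 && [|| p.1 == q.1, p.2 \in labeled | q.2 \in labeled].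
Proof.
apply/exists_inP/idP => [[p']|].
  rewrite in_square_class glueE => /andP[/eqP-> pp'] /exists_inP[q'].
  rewrite in_square_class glueE => /andP[/eqP-> qq'] /andP[/eqP p'q' ->] /=.
  case/orP: pp' => [/eqP->|->]; last by rewrite orbT.
  by case/orP: qq' => [/eqP->|->]; rewrite ?p'q' ?eqxx ?orbT.
have adjI p' q' : glue p p' -> glue q q' -> copies_adj p' q' ->
    exists2 p0, p0 \in val (square_class p) &
      [exists q0 in val (square_class q), copies_adj p0 q0].
  move=> pp' qq' adj_pq; exists p'; first by rewrite in_square_class.
  by apply/exists_inP; exists q'; rewrite ?in_square_class.
case: p q adjI => [b v] [c w] /= adjI /andP[vw].
case/or3P => [/eqP bc|vL|wL].
- by apply: (adjI (b, v) (c, w)); rewrite ?glue_refl // /copies_adj /= bc eqxx.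
- by apply: (adjI (c, v) (c, w)); rewrite /copies_adj ?glueE /= ?eqxx ?vL ?orbT.
- by apply: (adjI (b, v) (b, w)); rewrite /copies_adj ?glueE /= ?eqxx ?wL ?orbT.
Qed.

Lemma square_class_gluing : gluing labeled square_class.
Proof.
split; [exact: square_class_surj| |exact: square_class_adj| |].
- by move=> p q; rewrite square_class_eq glueE.
- by have [v vL] := theta_nonempty K; exists v; rewrite inE.
- by have [v vL] := theta_proper K; exists v; rewrite inE.
Qed.

End SquareGluing.

Lemma ex_nat_labeling (T : finType) (A : {set T}) :
  exists (D : {fset nat}) (t : D -> T), injective t /\ codom t =i A.
Proof.
pose D := [fset i in iota 0 #|A|]%fset.
have ltD (l : D) : val l < #|A| by have := valP l; rewrite !inE /= mem_iota.
exists D, (fun l => enum_val (Ordinal (ltD l))); split=> [k l|x].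
  by case/enum_val_inj=> /val_inj.
apply/codomP/idP => [[l ->]|xA]; first exact: enum_valP.
have rank_in : val (enum_rank_in xA x) \in D by rewrite !inE /= mem_iota /=.
exists (Sub (val (enum_rank_in xA x)) rank_in).
rewrite -[LHS](enum_rankK_in xA xA); congr enum_val; exact: val_inj.
Qed.

Lemma is_square_gluingP (G : sgraph) :
  is_square G <-> exists (K : sgraph) (L : {set K}) (f : bool * K -> G),
    gluing L f.
Proof.
split=> [[K [g [h gK hK] g_adj]]|[K [L [f f_glue]]]].
  exists K, (labeled K), (h \o @square_class K).
  apply: gluing_comp_isomorphism (square_class_gluing K); first by exists g.
  by move=> u w; rewrite -g_adj !hK.
have [D [t [t_inj codom_t]]] := ex_nat_labeling L.
have t_nonempty : exists v, v \in codom t.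
  by have [v vL] := gluing_labeled f_glue; exists v; rewrite codom_t.
have t_proper : exists v, v \notin codom t.
  by have [v vL] := gluing_unlabeled f_glue; exists v; rewrite codom_t.
pose P := PLGraph t_inj t_nonempty t_proper.
have labeledE : labeled P = L by apply/setP=> v; rewrite inE codom_t.
have P_glue : gluing L (@square_class P).
  by rewrite -labeledE; exact: square_class_gluing P.
by exists P; exact: gluing_isomorphic f_glue P_glue.
Qed.

Record reflection (G : sgraph) (s : G -> G) (A : {set G}) : Prop := Reflection {
  reflectionK : involutive s;
  reflection_adj : forall x y, adj (s x) (s y) = adj x y;
  reflection_disjoint : forall x, x \in A -> s x \notin A;
  reflection_fixed : forall x, (s x == x) = (x \notin A) && (s x \notin A);
  reflection_nonadj : forall x y, x \in A -> y \in A -> ~~ adj x (s y);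
  reflection_ex_fixed : exists x, s x = x;
  reflection_ex_moved : exists x, x \in A
}.

Section GluingReflection.
Variables (K : sgraph) (L : {set K}) (G : sgraph) (f : bool * K -> G).
Hypothesis f_glue : gluing L f.

Lemma gluing_ind (P : G -> Prop) : (forall b v, P (f (b, v))) -> forall x, P x.
Proof. by move=> Pf x; have [[b v] <-] := gluing_surj f_glue x. Qed.

Lemma gluing_ex_swap :
  exists s : G -> G, forall b v, s (f (b, v)) = f (~~ b, v).
Proof.
have /fin_all_exists[s sE] x :
    exists y, forall b v, f (b, v) = x -> y = f (~~ b, v).
  have [[b v] <-] := gluing_surj f_glue x.
  exists (f (~~ b, v)) => c w /esym/eqP.
  rewrite (gluing_eq f_glue) /= => bv_cw.
  by apply/eqP; rewrite (gluing_eq f_glue) /= (inj_eq negb_inj).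
by exists s => b v; exact: sE.
Qed.

Lemma mem_unlabeled_copy b v :
  (f (b, v) \in [set f (true, w) | w in ~: L]) = b && (v \notin L).
Proof.
apply/imsetP/andP => [[w]|[-> vL]]; last by exists v; rewrite ?inE.
rewrite inE => wL /eqP; rewrite (gluing_eq f_glue) /= => /andP[/eqP vw].
by rewrite vw (negbTE wL) orbF eqb_id.
Qed.

Lemma gluing_ex_reflection : exists (s : G -> G) (A : {set G}), reflection s A.
Proof.
have [s sE] := gluing_ex_swap; exists s, [set f (true, w) | w in ~: L].
split.
- by elim/gluing_ind=> b v; rewrite !sE negbK.
- elim/gluing_ind=> b v; elim/gluing_ind=> c w.
  by rewrite !sE !(gluing_adj f_glue) /= (inj_eq negb_inj).
- by elim/gluing_ind=> b v; rewrite sE !mem_unlabeled_copy => /andP[->].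
- elim/gluing_ind=> b v; rewrite sE !mem_unlabeled_copy (gluing_eq f_glue) /=.
  by rewrite eqxx; case: b (v \in L) => [] [].
- elim/gluing_ind=> b v; elim/gluing_ind=> c w.
  rewrite sE !mem_unlabeled_copy (gluing_adj f_glue) /=.
  by move=> /andP[-> /negbTE->] /andP[-> /negbTE->]; rewrite andbF.
- have [v vL] := gluing_labeled f_glue; exists (f (true, v)); apply/eqP.
  by rewrite sE (gluing_eq f_glue) /= eqxx vL.
- have [v vL] := gluing_unlabeled f_glue; exists (f (true, v)).
  by rewrite mem_unlabeled_copy vL.
Qed.

End GluingReflection.

Section Induced.
Variables (G : sgraph) (B : {set G}) (x0 : G).
Hypothesis x0B : x0 \in B.

Definition induced_adj : rel {x : G | x \in B} :=
  fun u v => adj (val u) (val v).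

Lemma induced_adj_sym : symmetric induced_adj.
Proof. by move=> u v; exact: adj_sym. Qed.

Lemma induced_adj_irrefl : irreflexive induced_adj.
Proof. by move=> u; exact: adj_irrefl. Qed.

Lemma induced_vertex_gt0 : 0 < #|{: {x : G | x \in B}}|.
Proof. by apply/card_gt0P; exists (Sub x0 x0B). Qed.

Definition induced : sgraph :=
  SGraph induced_adj_sym induced_adj_irrefl induced_vertex_gt0.

End Induced.

Section ReflectionGluing.
Variables (G : sgraph) (s : G -> G) (A : {set G}).
Hypothesis sA : reflection s A.

(* The union of A and the fixed vertices. *)
Definition half : {set G} := [set x | s x \notin A].

Lemma half_fixed x : x \in half -> (s x == x) = (x \notin A).
Proof. by rewrite inE (reflection_fixed sA) => ->; rewrite andbT. Qed.

Lemma half_cover x : (x \in half) || (s x \in half).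
Proof.
rewrite !inE (reflectionK sA) orbC -implybE.
by apply/implyP; exact: reflection_disjoint sA x.
Qed.

Lemma half_eq_reflected x y : x \in half -> y \in half ->
  (x == s y) = (x == y) && (s x == x).
Proof.
move=> xB yB; apply/eqP/andP => [xE|[/eqP<- /eqP->] //].
have sxE : s x = x.
  by apply/eqP; rewrite half_fixed // xE; move: yB; rewrite inE.
by rewrite -(can_eq (reflectionK sA) x) sxE -xE eqxx.
Qed.

Lemma half_adj_reflected x y : x \in half -> y \in half ->
  adj x (s y) = adj x y && ((s x == x) || (s y == y)).
Proof.
move=> xB yB; case: eqP => [sxE|/eqP].
  by rewrite andbT -{1}sxE (reflection_adj sA).
rewrite half_fixed // negbK => xA; case: eqP => [->|/eqP].
  by rewrite andbT.
rewrite half_fixed // negbK => yA.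
by rewrite andbF; apply/negbTE; exact: reflection_nonadj sA _ _ xA yA.
Qed.

Lemma reflection_ex_gluing :
  exists (K : sgraph) (L : {set K}) (f : bool * K -> G), gluing L f.
Proof.
have [x0 sx0] := reflection_ex_fixed sA.
have [x1 x1A] := reflection_ex_moved sA.
have x0B : x0 \in half.
  by rewrite inE; have := reflection_fixed sA x0; rewrite sx0 eqxx andbb.
have x1B : x1 \in half by rewrite inE (reflection_disjoint sA).
pose K := induced x0B.
exists K, [set v : K | s (val v) == val v].
exists (fun p => if p.1 then val p.2 else s (val p.2)).
split=> [x|[b v] [c w]|[b v] [c w]||] /=.
- have [xB|/negbTE xB] := boolP (x \in half); first by exists (true, Sub x xB).
  have sxB : s x \in half by have := half_cover x; rewrite xB.
  by exists (false, Sub (s x) sxB); exact: reflectionK sA x.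
- rewrite inE; case: b c => [] [] /=; rewrite ?andbT //.
  + by rewrite half_eq_reflected ?(valP v) ?(valP w).
  + rewrite eq_sym half_eq_reflected ?(valP v) ?(valP w) // eq_sym val_eqE.
    by case: eqP => [->|].
  + by rewrite (can_eq (reflectionK sA)).
- rewrite !inE; case: b c => [] [] /=; rewrite ?andbT //.
  + by rewrite half_adj_reflected ?(valP v) ?(valP w).
  + rewrite adj_sym half_adj_reflected ?(valP v) ?(valP w) // orbC.
    by rewrite [in LHS]adj_sym.
  + exact: reflection_adj sA _ _.
- by exists (Sub x0 x0B); rewrite inE /= sx0.
- by exists (Sub x1 x1B); rewrite inE /= half_fixed // x1A.
Qed.

End ReflectionGluing.

Lemma is_square_reflectionP (G : sgraph) :
  is_square G <-> exists (s : G -> G) (A : {set G}), reflection s A.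
Proof.
rewrite is_square_gluingP; split=> [[K [L [f f_glue]]]|[s [A sA]]].
  exact: gluing_ex_reflection f_glue.
exact: reflection_ex_gluing sA.
Qed.

Lemma lexprod_reflectionl (G H : sgraph) (s : G -> G) (A : {set G}) :
  reflection s A ->
  @reflection (lexprod G H) (fun p => (s p.1, p.2)) (setX A [set: H]).
Proof.
case=> sK s_adj s_disj s_fix s_nonadj [x0 sx0] [x1 x1A].
have /card_gt0P[h0 _] := vertex_gt0 H.
split=> [[x h]|[x h] [y k]|[x h]|[x h]|[x h] [y k]||]; rewrite ?inE ?andbT /=.
- by rewrite sK.
- by rewrite /lex_adj /= s_adj (can_eq sK).
- exact: s_disj.
- by rewrite xpair_eqE eqxx andbT s_fix.
- move=> xA yA; rewrite /lex_adj /= (negbTE (s_nonadj _ _ xA yA)) /=.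
  by apply: contraL xA => /andP[/eqP-> _]; exact: s_disj.
- by exists (x0, h0); rewrite /= sx0.
- by exists (x1, h0); rewrite !inE x1A.
Qed.

Lemma lexprod_reflectionr (G H : sgraph) (s : G -> G) (A : {set G}) (h0 : H) :
  reflection s A ->
  @reflection (lexprod H G)
    (fun p => (p.1, if p.1 == h0 then s p.2 else p.2)) (setX [set h0] A).
Proof.
case=> sK s_adj s_disj s_fix s_nonadj [x0 sx0] [x1 x1A].
split=> [[h x]|[h x] [k y]|[h x]|[h x]|[h x] [k y]||]; rewrite ?inE /=.
- by case: eqP => // _; rewrite sK.
- rewrite /lex_adj /=; case: (h =P k) => [<-|] //=.
  by case: eqP => // _; rewrite s_adj.
- by case: eqP => //= _; exact: s_disj.
- by rewrite xpair_eqE eqxx /=; case: (h == h0) => //=; rewrite eqxx.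
- case/andP=> /eqP-> xA /andP[/eqP-> yA].
  by rewrite /lex_adj /= adj_irrefl eqxx /=; exact: s_nonadj.
- by exists (h0, x0); rewrite /= eqxx sx0.
- by exists (h0, x1); rewrite !inE eqxx x1A.
Qed.

Theorem theorem5p7 (G H : sgraph) :
  is_square G -> is_square (lexprod G H) /\ is_square (lexprod H G).
Proof.
case/is_square_reflectionP=> s [A sA]; have /card_gt0P[h0 _] := vertex_gt0 H.
split; apply/is_square_reflectionP.
  by do 2!eexists; exact: lexprod_reflectionl sA.
by do 2!eexists; exact: lexprod_reflectionr h0 sA.
Qed.
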